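(* Let $r\geq 3$, $d\geq 0$, and $N\geq (d+1)(r-1)$ be integers, and let $A\colon \{1,\ldots,N+1\}\to\mathbb{R}^d$ be a function. Then there are pairwise disjoint subsets $\sigma_1,\ldots,\sigma_r\subseteq\{1,\ldots,N+1\}$ with $\operatorname{conv}(A(\sigma_1))\cap\cdots\cap\operatorname{conv}(A(\sigma_r))\neq\emptyset$, such that $\{1,2\}\nsubseteq\sigma_i$ for every $1\leq i\leq r$.
   Context: $\operatorname{conv}$ is the ordinary convex hull in $\mathbb{R}^d$, with $\operatorname{conv}(\emptyset)=\emptyset$. *)

(* Defs.v *)
From HB Require Import structures.
From mathcomp Require Import all_boot all_order all_algebra.
From mathcomp Require Import boolp classical_sets reals convex.

Set Implicit Arguments.
Unset Strict Implicit.
Unset Printing Implicit Defensive.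

Local Open Scope classical_set_scope.
Local Open Scope ring_scope.

(* [smallest] is the intersection of all convex supersets of [S]; the empty
   set is convex, so the hull of [set0] is [set0]. *)
Definition convex_hull (R : numDomainType) (M : lmodType R) (S : set M) :
  set M := smallest (@convex_set R M) S.

(* Main.v *)
Require Import Defs.
From HB Require Import structures.
From mathcomp Require Import all_boot all_order all_algebra.
From mathcomp Require Import boolp classical_sets reals convex.
From mathcomp Require Import interval_inference topology normedtype derive.
From mathcomp Require Import ring lra.

Import Order.TTheory GRing.Theory Num.Theory.
Import numFieldNormedType.Exports.
Set Implicit Arguments.
Unset Strict Implicit.
Unset Printing Implicit Defensive.
Local Open Scope classical_set_scope.
Local Open Scope ring_scope.

(** Sarkaria's tensor trick turns the statement into one about colour classes.
Write s = r - 1 and D = (d + 1) s, and send the point i and the part j to the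
vector P i j = (A i, 1) (x) e_j of R^D, where e_0, ..., e_s are vectors of R^s
whose only linear relation is e_0 + ... + e_s = 0. A choice c of one part for
each point and a convex combination of the vectors P i (c i) equal to 0 are
the same thing as a Tverberg partition: the relation says that all parts have
the same weighted sum of points and the same total weight. As sum_j P i j = 0
for each i, the colourful Caratheodory theorem [colourful_caratheodory] provides
such a c, which is Tverberg's theorem. The two points to be separated are points 0 and 1.

Suppose that c puts them both into part j. Freeze the classes of the remaining
points, and call two vectors v and w linked if 0 lies in the convex hull of v,
w and one vector from each remaining class. So P 0 j and P 1 j are linked.
The key is [linked_triangle]: if v and w are linked then, for every vector u,
u is linked to v or to w. With two more parts k and l, which exist as r >= 3,
apply it to u = P 1 k: either P 0 j and P 1 k are linked, and points 0 and 1
are separated, or P 1 k and P 1 j are linked. In the second case apply it to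
u = P 0 l: this vector is linked to P 1 j or to P 1 k, and the points are
separated again.

For [linked_triangle], suppose that u is linked neither to v nor to w, and slide
v and w together along segments to u. At the end of the motion both coincide
with u, and a link between u and u is a link between u and w; so it suffices to
show that the moving vectors stay linked. Some delta > 0 bounds from below the
squared distance to 0 of every convex hull of u, one of v and w, and a
colourful choice. A small step moves the linked hull to squared distance less
than delta from 0. The hull closest to 0, among all colourful choices, is then
also closer than delta, and Barany's exchange argument shows that it contains 0.
Indeed, let z be its nearest point and suppose that z is not 0. If all N + 1
vertices had positive weight in z, they would lie in the hyperplane supporting
the hull at z, and would be affinely dependent as D <= N; so z can be written
with a weight equal to 0 ([minimizer_on_face]). If this is the weight of a
colour class, its vertex can be replaced by one on the other side of the
hyperplane, which brings the hull closer to 0 ([minimizer_swap]). If it is the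
weight of the moving v or w, then z lies in a hull of u, one of v and w, and a
colourful choice, which contradicts the choice of delta. *)

(** * Scalar product of row vectors *)

Definition dot (R : realFieldType) D (y z : 'rV[R]_D) : R :=
  \sum_i y 0 i * z 0 i.

Section Dot.
Context {R : realFieldType} {D : nat}.
Implicit Types y z : 'rV[R]_D.

Lemma dotC y z : dot y z = dot z y.
Proof. by apply: eq_bigr => i _; rewrite mulrC. Qed.

Lemma dotDr z y1 y2 : dot z (y1 + y2) = dot z y1 + dot z y2.
Proof. by rewrite -big_split; apply: eq_bigr => i _; rewrite !mxE mulrDr. Qed.

Lemma dotZr z a y : dot z (a *: y) = a * dot z y.
Proof. by rewrite mulr_sumr; apply: eq_bigr => i _; rewrite !mxE mulrCA. Qed.

Lemma dot0r z : dot z 0 = 0.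
Proof. by rewrite -(scale0r 0) dotZr mul0r. Qed.

Lemma dot_sumr (I : Type) (s : seq I) z (f : I -> 'rV[R]_D) :
  dot z (\sum_(i <- s) f i) = \sum_(i <- s) dot z (f i).
Proof. by elim/big_rec2: _ => [|i a b _ <-]; rewrite ?dot0r ?dotDr. Qed.

Lemma dot_ge0 z : 0 <= dot z z.
Proof. by apply: sumr_ge0 => i _; rewrite -expr2 sqr_ge0. Qed.

Lemma dot_eq0 z : (dot z z == 0) = (z == 0).
Proof.
apply/eqP/eqP => [/psumr_eq0P z0|->]; last by rewrite dot0r.
apply/rowP => i; rewrite mxE; apply/eqP.
by rewrite -(sqrf_eq0 (z 0 i)) expr2 z0 // => j _; rewrite -expr2 sqr_ge0.
Qed.

Lemma dot_gt0 z : z != 0 -> 0 < dot z z.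
Proof. by move=> z0; rewrite lt_def dot_eq0 z0 dot_ge0. Qed.

Lemma dot_move z s y :
  dot (z + s *: y) (z + s *: y) = dot z z + 2 * s * dot z y + s ^+ 2 * dot y y.
Proof.
by rewrite dotDr dotZr (dotC _ z) (dotC _ y) !dotDr !dotZr (dotC y z); ring.
Qed.

Lemma dot_scale a y : dot (a *: y) (a *: y) = a ^+ 2 * dot y y.
Proof. by rewrite dotZr dotC dotZr mulrA expr2. Qed.

Lemma dot_add2 y z : dot (y + z) (y + z) <= 2 * (dot y y + dot z z).
Proof.
rewrite -big_split mulr_sumr; apply: ler_sum => i _; rewrite !mxE /=.
by have := sqr_ge0 (y 0 i - z 0 i); rewrite !expr2; nra.
Qed.

End Dot.

(** * Points of colourful simplices nearest to the origin *)

Lemma continuous_sumr (R : realType) (S : topologicalType) (I : Type) (s : seq I)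
    (f : I -> S -> R) :
  (forall i, continuous (f i)) -> continuous (fun x => \sum_(i <- s) f i x).
Proof.
move=> fc; elim: s => [|i s IH].
  by under eq_fun do rewrite big_nil; exact: cst_continuous.
by under eq_fun do rewrite big_cons; move=> x; apply: continuousD; [exact: fc|exact: IH].
Qed.

Lemma continuous_mulmx (R : realType) T D (V : 'M[R]_(T, D)) j :
  continuous (fun x : 'rV[R]_T => (x *m V) 0 j).
Proof.
under eq_fun do rewrite mxE; apply: continuous_sumr => i x.
by apply: continuousM; [exact: coord_continuous|exact: cst_continuous].
Qed.

Definition simplex (R : realType) T : set 'rV[R]_T :=
  [set x | (forall i, 0 <= x 0 i) /\ \sum_i x 0 i = 1].

Lemma simplex_vertex (R : realType) T (i : 'I_T) : simplex (delta_mx 0 i : 'rV[R]_T).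
Proof.
split=> [j|]; first by rewrite mxE ler0n.
by rewrite (bigD1 i) //= big1 => [|j ji]; rewrite mxE ?eqxx ?(negPf ji) ?andbF ?addr0.
Qed.

Lemma compact_simplex (R : realType) T : compact (@simplex R T).
Proof.
have -> : @simplex R T =
    \bigcap_(i : 'I_T) ((fun x : 'rV[R]_T => x 0 i) @^-1` [set a | 0 <= a]) `&`
    ((fun x : 'rV[R]_T => \sum_i x 0 i) @^-1` [set a | a = 1]).
  apply/seteqP; split=> x [x0 x1]; split=> // i; first by move=> _; exact: x0.
  exact: (x0 i I).
apply: (@subclosed_compact _ _ [set x : 'rV[R]_T | forall i, x 0 i \in `[0, 1]%R]).
- apply: closedI.
    apply: closed_bigI => i _; apply: closed_comp; last exact: closed_ge.
    by move=> x _; exact: coord_continuous.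
  apply: closed_comp; last exact: closed_eq.
  by move=> x _; apply: continuous_sumr => i; exact: coord_continuous.
- apply: (@rV_compact R _ (fun=> [set` `[0 : R, 1]%R])) => i.
  exact: segment_compact.
- move=> x [x0 x1] i; have xi j : 0 <= x 0 j by exact: (x0 j I).
  rewrite in_itv /= xi -x1 (bigD1 i) //= lerDl; exact: sumr_ge0.
Qed.

(** The matrix [V c] lists the vertices of one candidate simplex; the minimum is
taken over the points of all candidates at once, not of a single one. *)
Definition minimizer (R : realType) T D (F : Type) (V : F -> 'M[R]_(T, D)) c x :=
  simplex x /\
  forall d y, simplex y -> dot (x *m V c) (x *m V c) <= dot (y *m V d) (y *m V d).

Lemma minimizer_exists (R : realType) T D (F : finType) (V : F -> 'M[R]_(T.+1, D))
  (c0 : F) : exists c x, minimizer V c x.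
Proof.
pose f c x := dot (x *m V c) (x *m V c).
have fmin c : exists x, simplex x /\ forall y, simplex y -> f c x <= f c y.
  have [||x] := compact_EVT_min (f := f c) _ (@compact_simplex R T.+1).
  - by exists (delta_mx 0 0); exact: simplex_vertex.
  - apply: continuous_subspaceT; apply: continuous_sumr => j x.
    by apply: continuousM; exact: continuous_mulmx.
  rewrite inE => fx xmin; exists x; split=> // y fy; apply: xmin.
  by rewrite inE.
have {fmin} [g gmin] := choice fmin.
have [c _ cmin] := arg_minP (fun c => f c (g c)) (erefl : xpredT c0).
exists c, (g c); split=> [|d y fy]; first exact: (gmin c).1.
exact: le_trans (cmin d isT) ((gmin d).2 y fy).
Qed.

Section MinimizerTheory.
Context {R : realType} {T D : nat} {F : Type}.
Implicit Types (V : F -> 'M[R]_(T, D)) (x y u : 'rV[R]_T).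

(** The candidate [V d] need not be [V c]: if it contains the nearest point
[x *m V c], it lies beyond the same supporting hyperplane. *)
Lemma minimizer_first_order V c d x y :
  minimizer V c x -> x *m V d = x *m V c -> simplex y ->
  dot (x *m V c) (x *m V c) <= dot (x *m V c) (y *m V d).
Proof.
case=> -[x0 x1] xmin xVd [y0 y1].
set z := x *m V c; pose w := y *m V d; rewrite leNgt; apply/negP => ltzw.
pose p := dot z z - dot z w; pose q := dot (w - z) (w - z).
have p0 : 0 < p by rewrite subr_gt0.
have q0 : 0 <= q := dot_ge0 _.
have pq0 : 0 < p + q by rewrite ltr_wpDr.
pose s := p / (p + q).
have s0 : 0 < s by rewrite divr_gt0.
have s1 : s <= 1 by rewrite ler_pdivrMr // mul1r lerDl.
have sE : s * (p + q) = p by rewrite divfK // gt_eqF.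
have fs : simplex ((1 - s) *: x + s *: y).
  split=> [i|].
  - by rewrite !mxE addr_ge0 // mulr_ge0 // ?subr_ge0 // ltW.
  - under eq_bigr do rewrite !mxE.
    by rewrite big_split -!mulr_sumr x1 y1 /= !mulr1 subrK.
have := xmin d _ fs; rewrite mulmxDl -!scalemxAl xVd -/z -/w.
have -> : (1 - s) *: z + s *: w = z + s *: (w - z).
  by rewrite scalerBl scale1r scalerBr addrAC addrA.
rewrite dot_move -/q.
have -> : dot z (w - z) = - p by rewrite dotDr -scaleN1r dotZr /p; ring.
have := mulr_gt0 s0 p0; rewrite /z; nra.
Qed.

(** Moving along [u] from an interior point leaves the simplex through the
coordinate which minimizes x_i / - u_i among those with u_i < 0. *)
Lemma reach_face x u :
  (forall i, 0 < x 0 i) -> \sum_i u 0 i = 0 -> u != 0 ->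
  exists2 s, 0 < s & (forall i, 0 <= (x + s *: u) 0 i) /\
                     exists i, (x + s *: u) 0 i = 0.
Proof.
move=> x0 u0 un0.
have [i0 i0neg] : exists i, u 0 i < 0.
  apply/existsP; apply: contraNT un0; rewrite negb_exists => /forallP uge.
  have {}uge i : 0 <= u 0 i by rewrite leNgt uge.
  by apply/eqP/rowP => i; rewrite mxE (psumr_eq0P _ u0).
have [i /= ineg imin] := @arg_minP _ _ _ i0 (fun i => u 0 i < 0)
  (fun i => x 0 i / - u 0 i) i0neg.
exists (x 0 i / - u 0 i); first by rewrite divr_gt0 ?oppr_gt0.
split=> [j|]; last first.
  by exists i; rewrite !mxE invrN mulrN mulNr divfK ?lt_eqF // subrr.
rewrite !mxE; have [uj|uj] := ltP (u 0 j) 0; last first.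
  by rewrite addr_ge0 ?mulr_ge0 ?invr_ge0 ?oppr_ge0 // ltW.
have := imin j uj; rewrite ler_pdivlMr ?oppr_gt0 // mulrN => h.
by rewrite -[_ * u 0 j]opprK subr_ge0.
Qed.

(** If all weights were positive, every direction [v] with coordinate sum 0 would
satisfy <z, v V> = 0 at the nearest point z. So a direction that kills all
coordinates of [v *m V c] but one, at which z is nonzero, kills that one too.
This leaves only 1 + (D - 1) equations for T unknowns, and moving along a
nonzero solution keeps z until a weight vanishes. *)
Lemma minimizer_on_face V c x :
  (D < T)%N -> minimizer V c x -> x *m V c != 0 ->
  exists y, [/\ minimizer V c y, y *m V c = x *m V c & exists i, y 0 i = 0].
Proof.
move=> DT xmin z0; have [[xge x1] xle] := xmin.
have [/existsP[i /eqP xi]|xpos] := boolP [exists i, x 0 i == 0].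
  by exists x; split=> //; exists i.
have {}xpos i : 0 < x 0 i.
  by rewrite lt_def xge andbT; apply: contra xpos => xi; apply/existsP; exists i.
(* The coordinate of z at which the equation is redundant. *)
have [j zj] : exists j, (x *m V c) 0 j != 0.
  apply/existsP; apply: contraNT z0; rewrite negb_exists => /forallP z0.
  by apply/eqP/rowP => j; rewrite [RHS]mxE; apply/eqP; rewrite -[_ == _]negbK z0.
have : kermx (row_mx (const_mx 1 : 'cV[R]_T) (col' j (V c))) != 0.
  rewrite kermx_eq0 /row_free neq_ltn (leq_ltn_trans (rank_leq_col _)) //.
  by rewrite add1n prednK // (leq_trans _ (ltn_ord j)).
case/rowV0Pn=> u /sub_kermxP; rewrite mul_mx_row => /eqP.
rewrite row_mx_eq0 => /andP[/eqP u1 /eqP uV] un0.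
have {}u1 : \sum_i u 0 i = 0.
  move/rowP/(_ 0): u1; rewrite !mxE => e; rewrite -[RHS]e.
  by apply: eq_bigr => i _; rewrite mxE mulr1.
have simp (v : 'rV[R]_T) s : (forall i, 0 <= (x + s *: v) 0 i) ->
    \sum_i v 0 i = 0 -> simplex (x + s *: v).
  move=> ge0 v1; split=> //; under eq_bigr do rewrite !mxE.
  by rewrite big_split -mulr_sumr x1 v1 /= mulr0 addr0.
have ge (v : 'rV[R]_T) : v != 0 -> \sum_i v 0 i = 0 ->
    0 <= dot (x *m V c) (v *m V c).
  move=> vn0 v1; have [s s0 [vge _]] := reach_face xpos v1 vn0.
  have := minimizer_first_order xmin (erefl _) (simp _ _ vge v1).
  by rewrite mulmxDl -scalemxAl dotDr dotZr lerDl pmulr_rge0.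
have dot0 : dot (x *m V c) (u *m V c) = 0.
  apply: le_anti; rewrite ge // andbT.
  have := ge (-1 *: u); rewrite -!scalemxAl dotZr mulN1r oppr_ge0; apply.
  - by rewrite scaleN1r oppr_eq0.
  - by under eq_bigr do rewrite !mxE; rewrite -mulr_sumr u1 mulr0.
have uV0 : u *m V c = 0.
  have uj' i : i != j -> (u *m V c) 0 i = 0.
    rewrite eq_sym => /unlift_some[h -> _]; move/rowP/(_ h): uV.
    by rewrite !mxE => e; rewrite -[RHS]e; apply: eq_bigr => l _; rewrite mxE.
  apply/rowP => i; rewrite [RHS]mxE; have [->|/uj'//] := eqVneq i j.
  move: dot0; rewrite /dot (bigD1 j) //= big1 ?addr0 => [|l lj].
    by move/eqP; rewrite mulf_eq0 (negPf zj) => /eqP.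
  by rewrite uj' ?mulr0.
have [s s0 [uge uface]] := reach_face xpos u1 un0.
have zE : (x + s *: u) *m V c = x *m V c.
  by rewrite mulmxDl -scalemxAl uV0 scaler0 addr0.
exists (x + s *: u); split=> //; split; first exact: simp.
by move=> d y /xle; rewrite zE.
Qed.

(** Barany's exchange step. If vertex [i] has weight 0, it may be replaced without
losing the nearest point z. As its replacements sum to 0, one of them, p, has
<z, p> <= 0, which violates the first-order condition <z, p> >= <z, z> > 0. *)
Lemma minimizer_swap r V c x i (d : 'I_r -> F) :
  (0 < r)%N -> minimizer V c x -> x *m V c != 0 ->
  (forall j l, l != i -> row l (V (d j)) = row l (V c)) ->
  \sum_j row i (V (d j)) = 0 -> x 0 i != 0.
Proof.
case: r d => // r d _ xmin z0 dV dsum; apply/eqP => xi0.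
have [j jle] : exists j, dot (x *m V c) (row i (V (d j))) <= 0.
  apply/existsP; apply: contraT; rewrite negb_exists => /forallP dpos.
  have := dot_sumr (index_enum 'I_r.+1) (x *m V c) (fun j => row i (V (d j))).
  rewrite dsum dot0r => /esym/eqP; rewrite gt_eqF //.
  rewrite big_ord_recl ltr_pwDl //; first by rewrite ltNge dpos.
  by apply: sumr_ge0 => j _; rewrite ltW // ltNge dpos.
have xVd : x *m V (d j) = x *m V c.
  rewrite !mulmx_sum_row; apply: eq_bigr => l _.
  by have [->|/dV->//] := eqVneq l i; rewrite xi0 !scale0r.
have := minimizer_first_order xmin xVd (simplex_vertex _ i).
by rewrite -rowE => /le_trans/(_ jle); rewrite leNgt dot_gt0.
Qed.

End MinimizerTheory.

(** * Colourful simplices containing the origin *)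

(** Every vertex of the nearest simplex is exchangeable here, so the nearest point
can only be the origin. *)
Lemma colourful_caratheodory (R : realType) D n r (P : 'I_n.+1 -> 'I_r -> 'rV[R]_D) :
  (0 < r)%N -> (D <= n)%N -> (forall i, \sum_j P i j = 0) ->
  exists (c : 'I_n.+1 -> 'I_r) x,
    simplex x /\ x *m \matrix_i P i (c i) = 0.
Proof.
move=> r0 Dn Psum; pose V (c : {ffun 'I_n.+1 -> 'I_r}) := \matrix_i P i (c i).
have [c [x xmin]] := minimizer_exists V [ffun=> Ordinal r0].
exists c, x; split; first exact: xmin.1.
have [//|z0] := eqVneq (x *m V c) 0; exfalso.
have [y [ymin zE [i yi]]] := minimizer_on_face (Dn : D < n.+1)%N xmin z0.
rewrite -zE in z0.
pose d j := [ffun l => if l == i then j else c l].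
apply/eqP: yi; apply: (minimizer_swap (d := d) r0 ymin z0) => [j l /negPf li|].
  by apply/rowP => h; rewrite !mxE ffunE li.
by rewrite -[RHS](Psum i); apply: eq_bigr => j _; rewrite rowK ffunE eqxx.
Qed.

(** * Linked pairs of vectors *)

Definition ordcons (X : Type) n (x : X) (f : 'I_n -> X) (i : 'I_n.+1) : X :=
  if unlift ord0 i is Some j then f j else x.

Lemma ordcons0 X n (x : X) (f : 'I_n -> X) : ordcons x f ord0 = x.
Proof. by rewrite /ordcons unlift_none. Qed.

Lemma ordconsS X n (x : X) (f : 'I_n -> X) i : ordcons x f (lift ord0 i) = f i.
Proof. by rewrite /ordcons liftK. Qed.

Section Linked.
Context {R : realType} {D m r : nat} (Q : 'I_m -> 'I_r -> 'rV[R]_D).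
Implicit Types (u v w : 'rV[R]_D) (c : {ffun 'I_m -> 'I_r}).

Definition edge_mx v w c : 'M[R]_(m.+2, D) :=
  \matrix_l ordcons v (ordcons w (fun i => Q i (c i))) l.

Definition linked v w := exists c x, simplex x /\ x *m edge_mx v w c = 0.

Lemma mul_edge_mx v w c (x : 'rV_m.+2) :
  x *m edge_mx v w c = x 0 ord0 *: v + (x 0 (lift ord0 ord0) *: w +
    \sum_i x 0 (lift ord0 (lift ord0 i)) *: Q i (c i)).
Proof.
rewrite mulmx_sum_row !big_ord_recl !rowK !ordconsS !ordcons0.
by do 2!congr (_ + _); apply: eq_bigr => i _; rewrite rowK !ordconsS.
Qed.

Definition edge_weights (a b : R) (g : 'I_m -> R) : 'rV[R]_m.+2 :=
  \row_l ordcons a (ordcons b g) l.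

Lemma mul_edge_weights v w c a b g : edge_weights a b g *m edge_mx v w c =
  a *: v + (b *: w + \sum_i g i *: Q i (c i)).
Proof.
rewrite mul_edge_mx !mxE !ordconsS !ordcons0; do 2!congr (_ + _).
by apply: eq_bigr => i _; rewrite mxE !ordconsS.
Qed.

Lemma simplex_edge_weights a b g : 0 <= a -> 0 <= b -> (forall i, 0 <= g i) ->
  a + b + \sum_i g i = 1 -> simplex (edge_weights a b g).
Proof.
move=> a0 b0 g0 abg; split=> [l|].
  rewrite mxE; case: (unliftP ord0 l) => [k|] ->; rewrite ?ordcons0 ?ordconsS //.
  by case: (unliftP ord0 k) => [i|] ->; rewrite ?ordcons0 ?ordconsS.
rewrite !big_ord_recl !mxE !ordconsS !ordcons0 addrA -[RHS]abg; congr (_ + _).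
by apply: eq_bigr => i _; rewrite mxE !ordconsS.
Qed.

Lemma linkedC v w : linked v w -> linked w v.
Proof.
case=> c [x [[x0 x1]]]; rewrite mul_edge_mx => xE.
exists c, (edge_weights (x 0 (lift ord0 ord0)) (x 0 ord0)
  (fun i => x 0 (lift ord0 (lift ord0 i)))); split.
  by apply: simplex_edge_weights => //; rewrite -x1 !big_ord_recl; ring.
by rewrite mul_edge_weights addrCA.
Qed.

Hypotheses (r_gt0 : (0 < r)%N) (Dm : (D <= m.+1)%N).
Hypothesis Qsum : forall i, \sum_j Q i j = 0.

(** There are finitely many colourful choices and each hull is compact, so the
distance to the origin is attained. *)
Lemma not_linked_gap v w : ~ linked v w ->
  exists2 delta : R, 0 < delta & forall c x, simplex x ->
    delta <= dot (x *m edge_mx v w c) (x *m edge_mx v w c).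
Proof.
move=> nvw.
have [c [x [xS xle]]] := minimizer_exists (edge_mx v w) [ffun=> Ordinal r_gt0].
exists (dot (x *m edge_mx v w c) (x *m edge_mx v w c)) => //.
by apply/dot_gt0/eqP => x0; apply: nvw; exists c, x.
Qed.

(** The exchange argument with two extra vertices which cannot be exchanged: it
works as long as neither gets weight 0 at the nearest point, and a lower bound
[delta] on the faces opposite to them ensures this. *)
Lemma linked_of_small v w (delta : R) c0 x0 :
  (forall c x, simplex x -> x 0 ord0 = 0 \/ x 0 (lift ord0 ord0) = 0 ->
    delta <= dot (x *m edge_mx v w c) (x *m edge_mx v w c)) ->
  simplex x0 -> dot (x0 *m edge_mx v w c0) (x0 *m edge_mx v w c0) < delta ->
  linked v w.
Proof.
move=> gap x0S x0lt.
have [c [x xmin]] := minimizer_exists (edge_mx v w) [ffun=> Ordinal r_gt0].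
exists c, x; split; first exact: xmin.1.
have [//|z0] := eqVneq (x *m edge_mx v w c) 0; exfalso.
have [y [ymin zE [l yl]]] := minimizer_on_face (Dm : D < m.+2)%N xmin z0.
rewrite -zE in z0.
have small : dot (y *m edge_mx v w c) (y *m edge_mx v w c) < delta.
  by apply: le_lt_trans x0lt; exact: ymin.2.
have nongap : ~ (y 0 ord0 = 0 \/ y 0 (lift ord0 ord0) = 0).
  by move/(gap c y ymin.1); rewrite leNgt small.
case: (unliftP ord0 l) yl => [k|] -> yl; last by apply: nongap; left.
case: (unliftP ord0 k) yl => [i|] -> yl; last by apply: nongap; right.
pose d j := [ffun h => if h == i then j else c h].
apply/eqP: yl; apply: (minimizer_swap (d := d) r_gt0 ymin z0) => [j|].
  move=> h hi; rewrite !rowK; case: (unliftP ord0 h) hi => [{}h|] -> hi.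
    rewrite !ordconsS; case: (unliftP ord0 h) hi => [{}h|] -> hi.
      by rewrite !ordconsS ffunE ifN //; apply: contraNneq hi => ->.
    by rewrite !ordcons0.
  by rewrite !ordcons0.
by rewrite -[RHS](Qsum i); apply: eq_bigr => j _; rewrite rowK !ordconsS ffunE eqxx.
Qed.

(** Both ends of a link slide to [u] in steps of length 1/n. The step only has to be
short compared with [delta], which is the same all along the motion, so
n steps reach [u]. *)
Lemma linked_triangle u v w : linked v w -> linked u w \/ linked v u.
Proof.
move=> vw; have [?|nuw] := pselect (linked u w); first by left.
have [?|nvu] := pselect (linked v u); first by right.
exfalso; have [d1 d10 gap1] := not_linked_gap nuw.
have [d2 d20 gap2] := not_linked_gap nvu.
pose delta := Num.min d1 d2.
have delta0 : 0 < delta by rewrite lt_min d10.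
pose to_u (t : R) z := z + t *: (u - z).
(* If one moving end has weight 0, only the other one counts, say the one coming
   from w; it is on the segment from w to u, so the point lies in a hull of u
   and w. *)
have gap t c x : 0 <= t <= 1 -> simplex x ->
    x 0 ord0 = 0 \/ x 0 (lift ord0 ord0) = 0 ->
    delta <= dot (x *m edge_mx (to_u t v) (to_u t w) c)
                 (x *m edge_mx (to_u t v) (to_u t w) c).
  case/andP=> t0 t1 [xge x1] xb; rewrite mul_edge_mx.
  have split_to_u (a : R) z : a *: to_u t z = (a * t) *: u + (a * (1 - t)) *: z.
    by rewrite /to_u; apply/rowP => h; rewrite !mxE; ring.
  have t1' : 0 <= 1 - t by rewrite subr_ge0.
  move: x1; rewrite !big_ord_recl => x1.
  case: xb => xb; move: x1; rewrite xb scale0r !add0r => x1.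
  - rewrite split_to_u -addrA -mul_edge_weights.
    apply: (le_trans _ (gap1 _ _ _)); first by rewrite ge_min lexx.
    apply: simplex_edge_weights; rewrite ?mulr_ge0 //.
    by rewrite -mulrDr subrKC mulr1.
  - rewrite split_to_u [_ *: u + _]addrC -addrA -mul_edge_weights.
    apply: (le_trans _ (gap2 _ _ _)); first by rewrite ge_min lexx orbT.
    apply: simplex_edge_weights; rewrite ?mulr_ge0 //.
    by rewrite -mulrDr subrK mulr1.
(* A step of length e moves the combination equal to 0 to squared norm
   at most e ^+ 2 * C. *)
pose C := 2 * (dot (u - v) (u - v) + dot (u - w) (u - w)).
have C0 : 0 <= C by rewrite mulr_ge0 // addr_ge0 // dot_ge0.
pose n := Num.bound (C / delta).
have Cn : C < n%:R * delta.
  by rewrite -ltr_pdivrMr // archi_boundP // divr_ge0 // ltW.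
have n0 : 0 < n%:R :> R.
  by rewrite -(pmulr_lgt0 _ delta0); exact: le_lt_trans Cn.
have n1 : 1 <= n%:R :> R by move: n0; rewrite ltr0n => n0; rewrite ler1n.
have step t : 0 <= t -> t + n%:R^-1 <= 1 -> linked (to_u t v) (to_u t w) ->
    linked (to_u (t + n%:R^-1) v) (to_u (t + n%:R^-1) w).
  move=> t0 t1 [c [x [xS xE]]].
  have ni0 : 0 < n%:R^-1 :> R by rewrite invr_gt0.
  apply: (@linked_of_small _ _ delta c x) => //.
    by move=> c' x' x'S; apply: gap => //; rewrite t1 addr_ge0 // ltW.
  have -> : x *m edge_mx (to_u (t + n%:R^-1) v) (to_u (t + n%:R^-1) w) c =
      n%:R^-1 *: (x 0 ord0 *: (u - v) + x 0 (lift ord0 ord0) *: (u - w)).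
    rewrite -[RHS]add0r -xE !mul_edge_mx /to_u.
    by move: (\sum_i _) => G; apply/rowP => h; rewrite !mxE; ring.
  rewrite dot_scale; apply: (@le_lt_trans _ _ (n%:R^-1 * C)); last first.
    by rewrite mulrC ltr_pdivrMr // mulrC.
  have x_le1 i : 0 <= x 0 i <= 1.
    rewrite xS.1 -xS.2 (bigD1 i) //= lerDl; apply: sumr_ge0 => j _; exact: xS.1.
  rewrite expr2 -mulrA; apply: ler_wpM2l; first exact: ltW.
  rewrite -[leRHS]mul1r; apply: ler_pM; rewrite ?dot_ge0 ?invf_le1 ?(ltW ni0) //.
  apply: le_trans (dot_add2 _ _) _; apply: ler_wpM2l => //.
  have shrink i z : dot (x 0 i *: z) (x 0 i *: z) <= dot z z.
    rewrite dot_scale ler_piMl ?dot_ge0 //.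
    by have /andP[xi0 xi1] := x_le1 i; rewrite expr_le1.
  by apply: lerD; exact: shrink.
have all_t k : (k <= n)%N -> linked (to_u (k%:R / n%:R) v) (to_u (k%:R / n%:R) w).
  elim: k => [_|k IH kn]; first by rewrite mul0r /to_u !scale0r !addr0.
  rewrite -natr1 mulrDl mul1r; apply: step (IH (ltnW kn)).
    by rewrite divr_ge0.
  by rewrite -[X in _ + X]mul1r -mulrDl natr1 ler_pdivrMr // mul1r ler_nat.
(* At time 1 both ends are u, and the weight of the pair can be put on one u. *)
have := all_t n (leqnn n); rewrite divff ?gt_eqF // /to_u !scale1r !subrKC.
case=> c [x [[x0 x1]]]; rewrite mul_edge_mx => xE; apply: nuw.
exists c, (edge_weights (x 0 ord0 + x 0 (lift ord0 ord0)) 0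
  (fun i => x 0 (lift ord0 (lift ord0 i)))); split.
  apply: simplex_edge_weights => //; first by rewrite addr_ge0.
  by rewrite -x1 !big_ord_recl; ring.
by rewrite mul_edge_weights scale0r add0r scalerDl -addrA.
Qed.

End Linked.

(** * Colourful simplices with two separated vertices *)

(** A common part [j] of the first two points is repaired along the path
P 0 j, P 1 k, P 0 l, P 1 j with j, k, l distinct: one of its edges is linked,
and each of its edges joins different parts. *)
Lemma separated_transversal (R : realType) D m r
    (P : 'I_m.+2 -> 'I_r -> 'rV[R]_D) :
  (3 <= r)%N -> (D <= m.+1)%N -> (forall i, \sum_j P i j = 0) ->
  exists (c : 'I_m.+2 -> 'I_r) x, [/\ simplex x,
    x *m \matrix_i P i (c i) = 0 & c ord0 != c (lift ord0 ord0)].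
Proof.
move=> r3 Dm Psum; have r0 : (0 < r)%N by apply: leq_trans r3.
pose Q i := P (lift ord0 (lift ord0 i)).
have edgeE j k (c : {ffun 'I_m -> 'I_r}) :
    edge_mx Q (P ord0 j) (P (lift ord0 ord0) k) c =
    \matrix_i P i (ordcons j (ordcons k c) i).
  apply/row_matrixP => i; rewrite !rowK.
  case: (unliftP ord0 i) => [{}i|] ->; rewrite ?ordcons0 ?ordconsS //.
  by case: (unliftP ord0 i) => [{}i|] ->; rewrite ?ordcons0 ?ordconsS.
have from_linked j k : j != k ->
    linked Q (P ord0 j) (P (lift ord0 ord0) k) ->
    exists (c : 'I_m.+2 -> 'I_r) x, [/\ simplex x,
      x *m \matrix_i P i (c i) = 0 & c ord0 != c (lift ord0 ord0)].
  move=> jk [c [x [xS]]]; rewrite edgeE => xE.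
  by exists (ordcons j (ordcons k c)), x; rewrite ordconsS !ordcons0.
have [c [x [xS xE]]] := colourful_caratheodory r0 Dm Psum.
have [cE|?] := eqVneq (c ord0) (c (lift ord0 ord0)); last by exists c, x.
pose j := c ord0.
have lnk : linked Q (P ord0 j) (P (lift ord0 ord0) j).
  exists [ffun i => c (lift ord0 (lift ord0 i))], x; split=> //.
  rewrite edgeE -[RHS]xE; congr (_ *m _); apply/row_matrixP => i; rewrite !rowK.
  case: (unliftP ord0 i) => [{}i|] ->; rewrite ?ordcons0 ?ordconsS //.
  by case: (unliftP ord0 i) => [{}i|] ->; rewrite ?ordcons0 ?ordconsS ?ffunE -?cE.
have avoid (k : 'I_r) : exists2 l, l != j & l != k.
  have : (0 < #|predC (pred2 j k)|)%N.
    rewrite -(ltn_add2l #|pred2 j k|) cardC card_ord addn0 card2.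
    by case: eqP => _; rewrite ?(leq_trans _ r3).
  by case/card_gt0P => l; rewrite !inE negb_or => /andP[]; exists l.
have [k kj _] := avoid j; have [l lj lk] := avoid k.
have Qsum i : \sum_j Q i j = 0 by exact: Psum.
have [lnk1|] := linked_triangle r0 Dm Qsum (P (lift ord0 ord0) k) lnk; last first.
  by apply: from_linked; rewrite eq_sym.
have [|/linkedC] := linked_triangle r0 Dm Qsum (P ord0 l) lnk1.
  exact: from_linked.
exact: from_linked.
Qed.

(** * Weighted averages in convex hulls *)

Lemma convex_hull_average (R : realType) d (I : finType) (p : pred I)
    (A : I -> 'rV[R]_d) (x : I -> R) :
  (forall i, 0 <= x i) -> 0 < \sum_(i | p i) x i ->
  convex_hull (A @` [set i | p i])
    ((\sum_(i | p i) x i)^-1 *: \sum_(i | p i) x i *: A i).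
Proof.
move=> x0 sum0 C [Ccvx AC].
(* Pairs (total weight, weighted sum) whose average lies in C; the pair (0, 0)
   is included so that points of weight 0 may be added. *)
pose K (s : R) (Y : 'rV[R]_d) := (s = 0 /\ Y = 0) \/ (0 < s /\ C (s^-1 *: Y)).
suff [[s0 _]|[]//] : K (\sum_(i | p i) x i) (\sum_(i | p i) x i *: A i).
  by rewrite s0 ltxx in sum0.
apply: (big_rec2 K); first by left.
have Kadd s Y t Z : K s Y -> K t Z -> K (s + t) (Y + Z).
  move=> [[-> ->]|[s0 sY]] [[-> ->]|[t0 tZ]]; rewrite ?add0r ?addr0.
  - by left.
  - by right.
  - by right.
  right; have st0 : 0 < s + t by rewrite addr_gt0.
  split=> //; have l0 : 0 <= s / (s + t) by rewrite divr_ge0 // ltW.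
  have l1 : s / (s + t) <= 1 by rewrite ler_pdivrMr // mul1r lerDl ltW.
  have -> : (s + t)^-1 *: (Y + Z) =
      (s / (s + t)) *: (s^-1 *: Y) + (1 - s / (s + t)) *: (t^-1 *: Z).
    by apply/rowP => i; rewrite !mxE; field; rewrite !gt_eqF.
  exact: set_mem (Ccvx _ _ (Itv01 l0 l1) (mem_set sY) (mem_set tZ)).
move=> i s Y pi; apply: Kadd => //.
have [->|xi0] := eqVneq (x i) 0; first by left; rewrite scale0r.
right; rewrite lt_def xi0 x0 scalerA mulVf // scale1r; split=> //.
by apply: AC; exists i.
Qed.

(** * From parts to colour classes *)

(** The tensor product of [b] with the basis vector of R^s numbered by [j], or with
minus the sum of the basis when [j] is the last of the s + 1 parts. *)
Definition sarkaria (R : realType) s D (b : 'rV[R]_D) (j : 'I_s.+1) : 'rV[R]_(s * D) :=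
  mxvec ((\col_q ((lift ord_max q == j)%:R - (j == ord_max)%:R)) *m b).

Lemma sum_sarkaria (R : realType) s D (b : 'rV[R]_D) : \sum_j @sarkaria R s D b j = 0.
Proof.
rewrite -linear_sum -mulmx_suml /=; set M := (\sum_j _).
suff -> : M = 0 by rewrite mul0mx linear0.
apply/colP => q; rewrite summxE mxE.
under eq_bigr do rewrite mxE.
rewrite sumrB (bigD1 (lift ord_max q)) //= eqxx big1 => [|j /negPf]; last first.
  by rewrite eq_sym => ->.
by rewrite (bigD1 ord_max) //= eqxx big1 ?addr0 ?subrr // => j /negPf ->.
Qed.

(** Coordinate [q] of the tensor relation compares part [q] with the last part. *)
Lemma sarkaria_balanced (R : realType) s D n (b : 'I_n -> 'rV[R]_D)
    (c : 'I_n -> 'I_s.+1) (x : 'I_n -> R) :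
  \sum_i x i *: sarkaria (b i) (c i) = 0 ->
  forall j, \sum_(i | c i == j) x i *: b i = \sum_(i | c i == ord_max) x i *: b i.
Proof.
move=> sum0 j; case: (unliftP ord_max j) => [q|] -> //; apply/eqP.
rewrite -subr_eq0 [X in X - _]big_mkcond [X in _ - X]big_mkcond -sumrB /=.
have := congr1 (row q \o vec_mx) sum0; rewrite /= !linear0 linear_sum /= => e.
rewrite -[X in _ == X]e linear_sum; apply/eqP/eq_bigr => i _.
rewrite !linearZ /= mxvecK row_mul.
have -> : row q (\col_q0 ((lift ord_max q0 == c i)%:R - (c i == ord_max)%:R)) =
    ((c i == lift ord_max q)%:R - (c i == ord_max)%:R)%:M :> 'M[R]_1.
  by apply/rowP => k; rewrite ord1 !mxE mulr1n eq_sym.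
rewrite mul_scalar_mx scalerBl scalerBr.
by do 2!case: eqP => _; rewrite ?scale1r ?scale0r ?scaler0.
Qed.

(* The index set {1, ..., N+1} is shifted to 'I_N.+1 = {0, ..., N}, so the
   indices 1 and 2 become [ord0] and [inord 1]; the hypotheses force 2 <= N,
   hence [inord 1] does have value 1. *)
Theorem corollary2p9 (R : realType) (r d N : nat)
    (hr : (3 <= r)%N) (hN : ((d + 1) * (r - 1) <= N)%N)
    (A : 'I_N.+1 -> 'rV[R]_d) :
  exists sigma : 'I_r -> set 'I_N.+1,
    [/\ forall i j : 'I_r, i != j -> sigma i `&` sigma j = set0,
        \bigcap_(i in [set: 'I_r]) convex_hull (A @` sigma i) !=set0
      & forall i : 'I_r, ~ ([set ord0; inord 1] `<=` sigma i)].
Proof.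
case: r hr hN => // s hs; rewrite subSS subn0 mulnC.
case: N A => [A|m A hN]; first by rewrite leqn0 muln_eq0 addn1 orbF; case: s hs.
(* The last coordinate 1 records the total weight of a part. *)
pose b i : 'rV[R]_(d + 1) := row_mx (A i) 1%:M.
have [c [x [[x0 x1] xE c01]]] := separated_transversal hs hN
  (fun i => sum_sarkaria s (b i)).
move: xE; rewrite mulmx_sum_row; under eq_bigr do rewrite rowK.
move/sarkaria_balanced => bal.
have bE j : \sum_(i | c i == j) x 0 i *: b i =
    row_mx (\sum_(i | c i == j) x 0 i *: A i) (\sum_(i | c i == j) x 0 i)%:M.
  rewrite -[LHS]hsubmxK !linear_sum /=; congr row_mx.
    by apply: eq_bigr => i _; rewrite linearZ /= row_mxKl.
  by rewrite raddf_sum; apply: eq_bigr => i _; rewrite linearZ /= row_mxKr scalemx1.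
pose w := \sum_(i | c i == ord_max) x 0 i.
have balance j : \sum_(i | c i == j) x 0 i *: A i =
      \sum_(i | c i == ord_max) x 0 i *: A i /\ \sum_(i | c i == j) x 0 i = w.
  have := bal j; rewrite !bE => /eq_row_mx[-> /rowP/(_ 0)].
  by rewrite !mxE !mulr1n.
have w0 : 0 < w.
  have : s.+1%:R * w = 1.
    rewrite -[RHS]x1 (partition_big c xpredT) //= (eq_bigr (fun=> w)) => [|j _].
      by rewrite sumr_const card_ord mulr_natl.
    exact: (balance j).2.
  move=> sw; have := @ltr01 R; rewrite -[X in _ < X]sw pmulr_rgt0 //; exact: ltr0Sn.
exists (fun j => [set i | c i == j]); split.
- move=> i j ij; apply/seteqP; split=> // l [/= /eqP li /eqP lj].
  by move: ij; rewrite -li -lj eqxx.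
- exists (w^-1 *: \sum_(i | c i == ord_max) x 0 i *: A i) => j _.
  have [<- <-] := balance j; apply: convex_hull_average => //.
  by rewrite (balance j).2.
- move=> j sub; move: c01; have /eqP -> : c ord0 == j by apply: sub; left.
  have -> : lift ord0 ord0 = inord 1 :> 'I_m.+2 by apply: val_inj; rewrite /= inordK.
  have /eqP -> : c (inord 1) == j by apply: sub; right.
  by rewrite eqxx.
Qed.
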